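(* Let $l\geq 1$ be an integer. Consider the on-line majority edge-colouring game in which the final graph must have minimum degree $\delta=2l$. Then the Presenter has a strategy forcing the Algorithm to use at least five colours.
   Context: All graphs are finite and simple. A majority edge-colouring of a graph $G$ is a (not necessarily proper) colouring of the edges of $G$ such that, for every vertex $v$ of $G$ and every colour $c$, at most $d_G(v)/2$ of the edges incident with $v$ have colour $c$. On-line game with minimum degree $\delta$: the integer $\delta$ is fixed and known to both players before the game. Two players, the Presenter and the Algorithm, start with an edgeless graph. In each round the Presenter reveals one new edge, possibly using previously unused vertices (there is no bound on the number of vertices); its endpoints are identified to the Algorithm. The Algorithm must immediately and irrevocably assign a colour to this edge, knowing only the part of the graph revealed so far and its colouring. The Presenter may choose each edge depending on the whole history of the game, including all colours assigned so far. After finitely many rounds the Presenter ends the game; the graph formed by all revealed edges is the final graph (it has no vertices of degree $0$), and its minimum degree must equal $\delta$. Vertices of smaller degree may appear during the game. The Algorithm's goal is that the resulting colouring of the final graph is a majority edge-colouring. The Presenter has a strategy forcing the Algorithm to use at least $m$ colours if the Presenter can play so that, whatever the Algorithm does, the game ends with an admissible final graph and the resulting colouring either is not a majority edge-colouring of the final graph or uses at least $m$ distinct colours. *)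

(* Defs.v *)
From mathcomp Require Import all_boot.

Set Implicit Arguments.
Unset Strict Implicit.
Unset Printing Implicit Defensive.

(* Vertices and colours are natural numbers, so both supplies are unlimited.  *)
(* A pair (u, v) encodes the unordered edge {u, v}: [incident], [adjacent]    *)
(* and [legal_edge] do not depend on the orientation.                         *)
Definition vertex := nat.
Definition colour := nat.
Definition edge := (vertex * vertex)%type.

(* The revealed edges with their colours, in chronological order.  A history  *)
(* is also read as the edge-coloured graph it describes, whose vertices are   *)
(* the endpoints of its edges (hence none has degree 0).                      *)
Definition history := seq (edge * colour).

Definition edges (h : history) : seq edge := [seq ec.1 | ec <- h].

Definition vertices (h : history) : seq vertex :=
  undup (flatten [seq [:: e.1; e.2] | e <- edges h]).

Definition incident (v : vertex) (e : edge) : bool := (e.1 == v) || (e.2 == v).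

Definition adjacent (h : history) (u v : vertex) : bool :=
  ((u, v) \in edges h) || ((v, u) \in edges h).

Definition degree (h : history) (v : vertex) : nat :=
  count (incident v) (edges h).

Definition colour_degree (h : history) (v : vertex) (c : colour) : nat :=
  count (fun ec => incident v ec.1 && (ec.2 == c)) h.

Definition min_degree_eq (h : history) (d : nat) : Prop :=
  {in vertices h, forall v, d <= degree h v} /\
  (exists2 v, v \in vertices h & degree h v = d).

Definition majority_colouring (h : history) : Prop :=
  {in vertices h, forall v, forall c, 2 * colour_degree h v c <= degree h v}.

Definition nb_colours (h : history) : nat := size (undup [seq ec.2 | ec <- h]).

(* Revealing such an edge keeps the graph simple. *)
Definition legal_edge (h : history) (e : edge) : bool :=
  (e.1 != e.2) && ~~ adjacent h e.1 e.2.

(* [None] means that the Presenter ends the game. *)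
Definition presenter := history -> option edge.

Definition algorithm := history -> edge -> colour.

Definition legal_presenter (P : presenter) : Prop :=
  forall h e, P h = Some e -> legal_edge h e.

(* The history after [n] rounds; it no longer changes once the game has ended. *)
Fixpoint play (P : presenter) (A : algorithm) (n : nat) : history :=
  if n is n'.+1 then
    let h := play P A n' in
    if P h is Some e then rcons h (e, A h e) else h
  else [::].

Definition presenter_forces (d m : nat) : Prop :=
  exists P : presenter, legal_presenter P /\
    forall A : algorithm, exists n : nat,
      let h := play P A n in
      [/\ P h = None,
          min_degree_eq h d &
          ~ majority_colouring h \/ m <= nb_colours h].

(* Main.v *)
Require Import Defs.
From mathcomp Require Import all_boot zify.

Set Implicit Arguments.
Unset Strict Implicit.
Unset Printing Implicit Defensive.

(** Call the first two colours to appear in the game early and all later ones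
late.  While at most four colours are in use, there are two early and at most
two late ones.  Hence a vertex of degree [2l + 1] whose edges are all early, or
all late, carries more than [l] edges of a single colour, and the colouring
cannot be completed to a majority colouring: a vertex of degree at least [2l]
can be left as it is ([pure_doomed]).  All the Presenter has to force is such a
pure vertex.

To do so, the Presenter joins an early-pure vertex [u] to a late-pure vertex
[v].  If the new edge is early then [u] remains pure and its degree grows,
otherwise [v] does.  An untouched vertex is pure in both senses, so both kinds
are available at the start.  By induction on [a], the Presenter can force an
early-pure vertex of degree [a], unless a late-pure vertex of degree [2l + 1]
appears ([force_early_vertex]): to pass from [a] to [a + 1], keep one late-pure
vertex [v] and join it to newly built early-pure vertices [u] of degree [a]; as
long as this fails to produce an early-pure vertex of degree [a + 1], it is [v]
that grows, which happens at most [2l + 1] times.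

Once five colours have been used or a vertex cannot be repaired, the
Presenter brings the minimum degree to exactly [2l] regardless of the further
colours ([doomed_wins]).  Strategies are handled as well-founded trees, one
child per answer of the Algorithm, which are turned into functions of the
history at the end ([strategy_forces]). *)

(** * Strategy trees *)

(** This lives in [Type] rather than [Prop] so that a Presenter, which is a
function, can be computed from a tree without any choice principle. *)
Inductive strategy (goal : history -> Prop) : history -> Type :=
| Stop h : goal h -> strategy goal h
| Ask h e : legal_edge h e ->
    (forall c, strategy goal (rcons h (e, c))) -> strategy goal h.

(** The move of [w], a strategy from [h], once the history is [h ++ s].  On a
history that contradicts [w] the value [None] keeps the Presenter legal; no
play against [w] reaches such a history. *)
Fixpoint follow goal h (w : strategy goal h) (s : history) : option edge :=
  match w with
  | Stop _ _ => None
  | Ask _ e _ k =>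
      if s is (e', c) :: s' then
        if e' == e then follow (k c) s' else None
      else Some e
  end.

Lemma follow_legal goal h (w : strategy goal h) s e :
  follow w s = Some e -> legal_edge (h ++ s) e.
Proof.
elim: w s => [//|{}h e' legal_e' k IHk] [|[e2 c] s] /=.
  by case=> <-; rewrite cats0.
by case: eqP => // -> /IHk; rewrite cat_rcons.
Qed.

Lemma follow_play goal h (w : strategy goal h) (P : presenter) (A : algorithm) m :
  (forall s, P (h ++ s) = follow w s) -> play P A m = h ->
  exists n, P (play P A n) = None /\ goal (play P A n).
Proof.
elim: w m => [{}h goal_h|{}h e legal_e k IHk] m followP playP.
  by exists m; rewrite playP; have:= followP [::]; rewrite cats0.
apply: (IHk (A h e) m.+1) => [s|/=].
  by rewrite cat_rcons followP /= eqxx.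
by rewrite playP; have:= followP [::]; rewrite cats0 /= => ->.
Qed.

Lemma strategy_forces d m :
  strategy (fun h => min_degree_eq h d /\
                     (~ majority_colouring h \/ m <= nb_colours h)) [::] ->
  presenter_forces d m.
Proof.
move=> w; exists (follow w); split=> [h e /follow_legal //|A].
by have [n [? [? ?]]] := @follow_play _ _ w (follow w) A 0 (fun=> erefl) erefl; exists n.
Qed.

(** * Degrees and legality along a history *)

Lemma edges_cat h s : edges (h ++ s) = edges h ++ edges s.
Proof. exact: map_cat. Qed.

Lemma degree_cat h s v : degree (h ++ s) v = degree h v + degree s v.
Proof. by rewrite /degree edges_cat count_cat. Qed.

Lemma mem_vertices h v : (v \in vertices h) = (0 < degree h v).
Proof.
rewrite mem_undup /degree -has_count.
elim: (edges h) => //= e s IHs.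
by rewrite !inE IHs /incident orbA ![v == _]eq_sym.
Qed.

Lemma legal_edge_rcons h e c e' :
  legal_edge (rcons h (e, c)) e' =
    [&& legal_edge h e', e' != e & e' != (e.2, e.1)].
Proof.
case: e e' => [x y] [x' y']; rewrite /legal_edge /adjacent /edges map_rcons /=.
rewrite !mem_rcons !inE !xpair_eqE /=.
rewrite [(y' == x) && _]andbC.
by do ![case: (_ == _) => //=]; do ?[case: (_ \in _) => //=].
Qed.

(** Edges that are fixed in advance can be revealed whatever the colours
received: legality depends only on the underlying graph. *)
Lemma reveal_edges goal es h :
  all (legal_edge h) es ->
  pairwise (fun e e' => (e' != e) && (e' != (e.2, e.1))) es ->
  (forall s, edges s = es -> strategy goal (h ++ s)) -> strategy goal h.
Proof.
elim: es h => [|e es IHes] h /=; first by move=> _ _ /(_ [::]); rewrite cats0; exact.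
move=> /andP[legal_e legal_es] /andP[es_e es_pw] k.
apply: (Ask legal_e) => c; apply: IHes => // [|s s_es].
  apply/allP => e' e'es; rewrite legal_edge_rcons (allP legal_es) //=.
  exact: (allP es_e).
by rewrite cat_rcons; apply: k; rewrite /= s_es.
Qed.

(** * Ending the game *)

(** [maxn (degree h v) d] is the degree that [v] has in the final graph if no
more edges than necessary are added at [v]. *)
Definition doomed d h :=
  (5 <= nb_colours h) \/
  exists v c, maxn (degree h v) d < 2 * colour_degree h v c.

Definition fresh h := (\max_(v <- vertices h) v).+1.

Lemma lt_fresh h v : v \in vertices h -> v < fresh h.
Proof. by move=> vh; rewrite ltnS; apply: (@leq_bigmax_seq _ _ _ (fun i => i)). Qed.

Lemma fresh_degree0 h v : fresh h <= v -> degree h v = 0.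
Proof.
move=> le_v; apply/eqP; rewrite -leqn0 leqNgt -mem_vertices.
by apply/negP => /lt_fresh; rewrite ltnNge le_v.
Qed.

Lemma adjacent_degree h u v : adjacent h u v -> (0 < degree h u) && (0 < degree h v).
Proof.
rewrite /degree -!has_count => /orP[] uvh; apply/andP; split; apply/hasP;
  by [exists (u, v); rewrite /incident /= ?eqxx ?orbT
     |exists (v, u); rewrite /incident /= ?eqxx ?orbT].
Qed.

(** Besides the vertices of [h], this lists [d] new vertices, which the padding
below gives degree exactly [d]. *)
Definition padded d h := vertices h ++ iota (fresh h + d) d.

(** Join every vertex that lacks [k > 0] edges to the first [k] of the [d]
hubs [fresh h, ..., fresh h + d - 1].  All [d] new vertices of [padded d h] are
joined to all hubs, so the hubs too reach degree [d]. *)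
Definition padding d h : seq edge :=
  [seq (x, fresh h + j) | x <- padded d h, j <- iota 0 (d - degree h x)].

Lemma mem_padding d h x y : (x, y) \in padding d h ->
  [/\ x \in padded d h, fresh h <= y < fresh h + d &
      (x < fresh h) || (fresh h + d <= x)].
Proof.
case/allpairsPdep=> x' [j [xh lt_j [-> ->]]]; rewrite mem_iota in lt_j.
split=> //; first lia.
by move: xh; rewrite mem_cat mem_iota => /orP[/lt_fresh -> //|]; lia.
Qed.

Lemma padded_uniq d h : uniq (padded d h).
Proof.
rewrite cat_uniq undup_uniq iota_uniq andbT /=; apply/hasPn => x.
by rewrite mem_iota => ltx; apply/negP => /lt_fresh; lia.
Qed.

Lemma padding_legal d h : all (legal_edge h) (padding d h).
Proof.
apply/allP => -[x y] /mem_padding[_ yF xF]; apply/andP; split=> /=.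
  by rewrite neq_ltn; lia.
by apply/negP => /adjacent_degree; rewrite (@fresh_degree0 _ y) ?andbF //; lia.
Qed.

Lemma padding_pairwise d h :
  pairwise (fun e e' => (e' != e) && (e' != (e.2, e.1))) (padding d h).
Proof.
have: uniq (padding d h).
  apply: allpairs_uniq_dep => [|x _|]; [exact: padded_uniq | exact: iota_uniq|].
  by move=> [x j] [y k] _ _ /= [-> /addnI ->].
rewrite uniq_pairwise; apply: (sub_in_pairwise (P := mem (padding d h))); last by apply/allP.
move=> [x y] [x' y'] /mem_padding[_ yF _] /mem_padding[_ _ x'F] /=.
rewrite eq_sym => ->; apply/eqP => -[x'y _]; lia.
Qed.

Lemma count_incident_padding d h v :
  count (incident v) (padding d h) =
    \sum_(x <- padded d h) \sum_(j <- iota 0 (d - degree h x))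
      incident v (x, fresh h + j).
Proof. by rewrite -sum1_count big_mkcond big_allpairs_dep. Qed.

Lemma degree_padding d h v : v \in padded d h ->
  count (incident v) (padding d h) = d - degree h v.
Proof.
move=> vh; rewrite count_incident_padding (bigD1_seq v) ?padded_uniq //=.
rewrite [X in _ + X]big1_seq ?addn0 => [|x /andP[neq_xv _]].
  under eq_bigr => j _ do rewrite /incident eqxx /=.
  by rewrite sum1_size size_iota.
rewrite big1_seq // => j /andP[_]; rewrite mem_iota => lt_j.
rewrite /incident /= (negPf neq_xv) /=; case: eqP => // jv; exfalso.
by move: vh; rewrite mem_cat mem_iota => /orP[/lt_fresh|]; lia.
Qed.

Lemma degree_hub_ge d h v : fresh h <= v < fresh h + d ->
  d <= count (incident v) (padding d h).
Proof.
move=> vF; rewrite count_incident_padding big_cat /= -[leqLHS]addn0 addnC leq_add //.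
rewrite -[leqLHS](size_iota (fresh h + d)) -sum1_size big_seq [leqRHS]big_seq.
apply: leq_sum => x; rewrite mem_iota => xG.
rewrite fresh_degree0 ?subn0; last lia.
rewrite (bigD1_seq (v - fresh h)) ?iota_uniq ?mem_iota //=; last lia.
by rewrite /incident /= subnKC ?eqxx ?orbT //; lia.
Qed.

Lemma nb_colours_cat h s : nb_colours h <= nb_colours (h ++ s).
Proof.
apply: uniq_leq_size (undup_uniq _) _ => c.
by rewrite !mem_undup map_cat mem_cat => ->.
Qed.

Lemma colour_degree_le h v c : colour_degree h v c <= degree h v.
Proof. by rewrite /degree /edges count_map; apply: sub_count => ec /andP[]. Qed.

(** The padding turns a degree below [d] into exactly [d] and leaves the others
unchanged, hence preserves the violation; the new vertices of [padded d h]
make the minimum degree equal to [d] and not larger. *)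
Lemma doomed_wins d h : 0 < d -> doomed d h ->
  strategy (fun h => min_degree_eq h d /\
                     (~ majority_colouring h \/ 5 <= nb_colours h)) h.
Proof.
move=> d_gt0 doom.
apply: (reveal_edges (padding_legal d h) (padding_pairwise d h)) => s s_pad.
have degE v : degree (h ++ s) v = degree h v + count (incident v) (padding d h).
  by rewrite degree_cat {2}/degree s_pad.
have degP v : v \in padded d h -> degree (h ++ s) v = maxn (degree h v) d.
  by move=> vh; rewrite degE degree_padding // maxnE.
apply: Stop; split; first split.
- move=> v; rewrite mem_vertices degE addn_gt0 -mem_vertices => /orP[vh|].
    by rewrite -degE degP ?leq_maxr // mem_cat vh.
  rewrite -has_count => /hasP[[x y] /mem_padding[xP yF _] /orP[]/eqP /= xv].
    by rewrite -degE degP -?xv ?leq_maxr.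
  by apply: leq_trans (leq_addl _ _); apply: degree_hub_ge; rewrite -xv.
- have deg0 : degree h (fresh h + d) = 0 by apply: fresh_degree0; lia.
  have degd : degree (h ++ s) (fresh h + d) = d.
    by rewrite degP ?deg0 ?max0n // mem_cat mem_iota; lia.
  by exists (fresh h + d); rewrite ?mem_vertices degd.
case: doom => [five|[v [c many]]].
  by right; apply: leq_trans five (nb_colours_cat h s).
left=> maj.
have vh : v \in vertices h.
  by rewrite mem_vertices; have := colour_degree_le h v c; lia.
have vhs : v \in vertices (h ++ s).
  by rewrite mem_vertices degE; move: vh; rewrite mem_vertices; lia.
have := maj v vhs c; rewrite degP; last by rewrite mem_cat vh.
by rewrite /colour_degree count_cat -/(colour_degree h v c); lia.
Qed.

(** * Early and late colours *)

(** The distinct colours in order of first appearance: [undup] keeps last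
occurrences, whence the two reversals. *)
Definition palette (h : history) : seq colour := rev (undup (rev [seq ec.2 | ec <- h])).

Definition early h c := index c (palette h) < 2.

(** With [b = true] all the edges at [v] are early, with [b = false] late. *)
Definition pure (h : history) b v :=
  all (fun ec => incident v ec.1 ==> (early h ec.2 == b)) h.

Lemma mem_palette h ec : ec \in h -> ec.2 \in palette h.
Proof. by move=> ech; rewrite mem_rev mem_undup mem_rev map_f. Qed.

(** The palette only grows at its end, so a colour never changes class; this is
what lets purity persist while the game goes on. *)
Lemma early_cat h s ec : ec \in h -> early (h ++ s) ec.2 = early h ec.2.
Proof.
move=> /mem_palette ech; rewrite /early /palette map_cat rev_cat undup_cat rev_cat.
by rewrite -/(palette h) index_cat ech.
Qed.

Lemma pure_cat h s b v :
  pure (h ++ s) b v = pure h b v &&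
    all (fun ec => incident v ec.1 ==> (early (h ++ s) ec.2 == b)) s.
Proof.
by rewrite /pure all_cat; congr (_ && _); apply: eq_in_all => ec /early_cat ->.
Qed.

Lemma pure_degree_le h b v (T : seq colour) :
  pure h b v -> {in h, forall ec, early h ec.2 == b -> ec.2 \in T} ->
  degree h v <= \sum_(c <- T) colour_degree h v c.
Proof.
move=> pure_v early_T; rewrite /degree /edges count_map -sum1_count big_mkcond /=.
under [leqRHS]eq_bigr => c _ do rewrite /colour_degree -sum1_count big_mkcond /=.
rewrite exchange_big /= big_seq [leqRHS]big_seq; apply: leq_sum => ec ech.
case: ifP => //= v_ec.
have ecT : ec.2 \in T.
  by apply: (early_T ec) => //; move/allP: pure_v => /(_ _ ech); rewrite v_ec.
by rewrite (big_rem _ ecT) /= eqxx.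
Qed.

(** If fewer than five colours are in use then each class has at most two, and
[2l + 1] edges in two colours include [l + 1] of the same colour. *)
Lemma pure_doomed l h b v :
  pure h b v -> degree h v = (2 * l).+1 -> doomed (2 * l) h.
Proof.
move=> pure_v deg_v; have [five|few] := leqP 5 (nb_colours h); first by left.
have size_pal : size (palette h) <= 4.
  rewrite size_rev -ltnS; apply: leq_trans few.
  apply: uniq_leq_size (undup_uniq _) _ => c.
  by rewrite !mem_undup mem_rev.
pose T := (if b then take 2 else drop 2) (palette h).
have size_T : size T <= 2.
  rewrite /T; case: (b); last by rewrite size_drop leq_subLR.
  by rewrite size_take_min geq_minl.
have early_T : {in h, forall ec, early h ec.2 == b -> ec.2 \in T}.
  move=> ec /mem_palette ecp; rewrite /T /early; case: (b) => [/eqP lt2|/eqP ge2].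
    by rewrite in_take.
  move: (ecp); rewrite -{1}(cat_take_drop 2 (palette h)) mem_cat in_take //.
  by rewrite ge2.
right; exists v; have := pure_degree_le pure_v early_T; rewrite deg_v.
have [/hasP[c _ cl] _|/hasPn few_T] := boolP (has (fun c => l < colour_degree h v c) T).
  by exists c; lia.
have: \sum_(c <- T) colour_degree h v c <= \sum_(c <- T) l.
  by rewrite big_seq [leqRHS]big_seq; apply: leq_sum => c /few_T; rewrite -leqNgt.
have : l * size T <= l * 2 by rewrite leq_mul2l size_T orbT.
by rewrite big_const_seq count_predT iter_addn_0; lia.
Qed.

(** * Forcing a pure vertex *)

Lemma pure_untouched h s b v : degree s v = 0 -> pure (h ++ s) b v = pure h b v.
Proof.
move=> s_v; rewrite pure_cat andb_idr // => _; apply/allP => ec ecs.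
apply/implyP => v_ec; exfalso; move/eqP: s_v; apply/negP; rewrite -lt0n.
by rewrite /degree -has_count; apply/hasP; exists ec.1; rewrite ?map_f.
Qed.

Lemma pure_isolated h b v : degree h v = 0 -> pure h b v.
Proof. by move=> h_v; rewrite -[h]cat0s pure_untouched. Qed.

Lemma pure_rcons h e c b v : pure h b v -> early (rcons h (e, c)) c = b ->
  pure (rcons h (e, c)) b v.
Proof. by move=> pv; rewrite -cats1 pure_cat pv /= => ->; rewrite eqxx implybT. Qed.

Lemma degree_rcons h e c v : degree (rcons h (e, c)) v = degree h v + incident v e.
Proof. by rewrite -cats1 degree_cat /degree /= addn0. Qed.

Lemma adjacent_cat h s u v : adjacent (h ++ s) u v = adjacent h u v || adjacent s u v.
Proof. by rewrite /adjacent edges_cat !mem_cat orbACA. Qed.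

(** The continuation receives the extension [s] in which [u] was built.  The
bound [N] confines [s] to vertices from [N] on: in the induction, this keeps the
late-pure vertex [v] untouched and not adjacent to [u] while the next [u] is
being built. *)
Lemma force_early_vertex goal D :
  (forall h v, degree h v = D -> pure h false v -> strategy goal h) ->
  forall a h N, fresh h <= N ->
  (forall s u, (forall v, v < N -> degree s v = 0) -> N <= u ->
     degree (h ++ s) u = a -> pure (h ++ s) true u -> strategy goal (h ++ s)) ->
  strategy goal h.
Proof.
move=> late_wins; elim=> [|a IHa] h N hN k.
  have N0 : degree h N = 0 by apply: fresh_degree0.
  by have:= k [::] N; rewrite cats0; apply=> //; apply: pure_isolated.
(* [m] counts how often the late-pure vertex [v] can still grow. *)
suff grow_late m s v : (forall w, w < N -> degree s w = 0) -> N <= v ->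
    m + degree (h ++ s) v = D -> pure (h ++ s) false v -> strategy goal (h ++ s).
  have N0 : degree h N = 0 by apply: fresh_degree0.
  have:= grow_late D [::] N; rewrite cats0 N0 addn0; apply=> //.
  exact: pure_isolated.
elim: m s v => [|m IHm] s v sN Nv deg_v pure_v; first exact: late_wins deg_v pure_v.
apply: (IHa _ (maxn (fresh (h ++ s)) v.+1)); first exact: leq_maxl.
move=> s' u s'0; rewrite geq_max => /andP[u_fresh lt_vu] deg_u pure_u.
have s'v : degree s' v = 0 by apply: s'0; rewrite leq_maxr.
have N_fresh w : w < N -> w < maxn (fresh (h ++ s)) v.+1 by lia.
have legal_uv : legal_edge ((h ++ s) ++ s') (u, v).
  rewrite /legal_edge /= gtn_eqF //= adjacent_cat; apply/negP => /orP[] /adjacent_degree.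
    by rewrite (fresh_degree0 u_fresh).
  by rewrite s'v andbF.
apply: (Ask legal_uv) => c.
have E : rcons ((h ++ s) ++ s') ((u, v), c) = h ++ (s ++ rcons s' ((u, v), c)).
  by rewrite -!cats1 !catA.
have sN' w : w < N -> degree (s ++ rcons s' (u, v, c)) w = 0.
  move=> wN; rewrite degree_cat degree_rcons sN // s'0 ?N_fresh //.
  by rewrite /incident /= !gtn_eqF //; lia.
rewrite E.
case: (boolP (early (rcons ((h ++ s) ++ s') ((u, v), c)) c)) => [c_early|/negbTE c_late].
  apply: (k _ u) => //; first lia.
    by rewrite -E degree_rcons deg_u /incident eqxx addn1.
  by rewrite -E; apply: pure_rcons.
apply: (IHm _ v) => //.
  by rewrite -E degree_rcons degree_cat s'v /incident eqxx orbT; lia.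
by rewrite -E; apply: pure_rcons c_late; rewrite pure_untouched.
Qed.

Theorem theorem4 (l : nat) (hl : 1 <= l) : presenter_forces (2 * l) 5.
Proof.
apply: strategy_forces.
have pure_wins h b v : degree h v = (2 * l).+1 -> pure h b v ->
    strategy (fun h => min_degree_eq h (2 * l) /\
                       (~ majority_colouring h \/ 5 <= nb_colours h)) h.
  by move=> deg_v pure_v; apply: doomed_wins (pure_doomed pure_v deg_v); lia.
apply: (@force_early_vertex _ (2 * l).+1 _ (2 * l).+1 _ (fresh [::])) => // [h v|s u _ _].
  exact: pure_wins.
exact: pure_wins.
Qed.
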